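(* For every integer $k\ge 5$, every outer $k$-planar graph $G$ on $n$ vertices has at most $2.85\sqrt{k}\,n$ edges.
   Context: A convex geometric graph is a drawing of a finite simple graph in the plane whose vertex set is a set of points in convex position (no three collinear) and whose edges are drawn as straight-line segments between their endpoints. Two edges cross if they share a point in their relative interiors. The drawing is $k$-plane if each edge crosses at most $k$ other edges. A graph is outer $k$-planar if it admits a convex geometric $k$-plane drawing. *)

(* Defs.v *)
From HB Require Import structures.
From mathcomp Require Import all_boot all_order all_algebra.
From mathcomp Require Import mathcomp_extra boolp classical_sets set_interval.
From mathcomp Require Import reals convex.

Set Implicit Arguments.
Unset Strict Implicit.
Unset Printing Implicit Defensive.

Import Order.TTheory GRing.Theory Num.Theory.

Local Open Scope ring_scope.
Local Open Scope classical_set_scope.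

Record sgraph := SGraph {
  vertex :> finType;
  adj : rel vertex;
  adj_sym : symmetric adj;
  adj_irrefl : irreflexive adj }.

(* As [adj] is irreflexive, every element of [edges G] has cardinality 2. *)
Definition edges (G : sgraph) : {set {set G}} :=
  [set [set x; y] | x in G, y in G & adj x y]%SET.

Definition plane (R : realType) := 'rV[R]_2.

Definition hull (R : realType) (A : set (plane R)) : set (plane R) :=
  smallest (@convex_set R 'rV[R]_2) A.

Definition collinear (R : realType) (A : set (plane R)) : Prop :=
  exists a d : plane R, d != 0 /\ A `<=` [set a + t *: d | t in [set: R]].

Definition convex_position (R : realType) (V : finType) (p : V -> plane R) :=
  forall v, ~ hull (p @` [set u | u != v]) (p v).

Definition no_three_collinear (R : realType) (V : finType)
    (p : V -> plane R) :=
  forall u v w, u != v -> v != w -> u != w -> ~ collinear [set p u; p v; p w].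

(* A straight-line drawing is determined by the positions of its vertices. *)
Definition convex_geometric (R : realType) (G : sgraph) (p : G -> plane R) :=
  [/\ injective p, convex_position p & no_three_collinear p].

Definition open_segment (R : realType) (a b : plane R) : set (plane R) :=
  [set (1 - t) *: a + t *: b | t in `]0, 1[%classic].

(* Relative interior of the segment drawing the edge [E]; the choice of
   orientation of [E] is irrelevant. *)
Definition edge_relint (R : realType) (G : sgraph) (p : G -> plane R)
    (E : {set G}) : set (plane R) :=
  [set z | exists x y, E = [set x; y]%SET /\ open_segment (p x) (p y) z].

Definition crosses (R : realType) (G : sgraph) (p : G -> plane R)
    (E F : {set G}) : Prop :=
  E != F /\ edge_relint p E `&` edge_relint p F !=set0.

Definition k_plane (R : realType) (k : nat) (G : sgraph) (p : G -> plane R) :=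
  forall E, E \in edges G ->
    (#|[set F in edges G | `[< crosses p E F >]]%SET| <= k)%N.

Definition outer_k_planar (R : realType) (k : nat) (G : sgraph) : Prop :=
  exists p : G -> plane R, convex_geometric p /\ k_plane k p.

(* Main.v *)
Require Import Defs.
From mathcomp Require Import all_boot all_order all_algebra.
From mathcomp Require Import boolp classical_sets interval_inference.
From mathcomp Require Import reals convex zify ring lra.

(** The bound comes from degeneracy.  Let [t] be the least natural number with
[k < t ^ 2].  Every nonempty set of vertices spans a subgraph with a vertex of
degree at most [2 t] ([exists_low_degree_vertex]); deleting such vertices one
by one destroys at most [2 t] edges each time, so there are at most [2 t n]
edges ([edges_le_of_degenerate]).  As [t <= sqrt k + 1], this is at most
[(2 sqrt k + 2) n], and [2 sqrt k + 2 <= 2.85 sqrt k] from [k = 6] on, while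
for [k = 5] the integrality of [t = 3] gives [6 <= 2.85 sqrt 5].

Geometry only serves to reach a combinatorial model.  Points in convex
position can be listed as [s_0, s_1, ...] so that all triples with increasing
indices turn left ([exists_counterclockwise_enum]), and then chords whose
endpoints alternate in this list cross ([chords_meet]).  So if [s_a s_b] is an
edge with [a < b], all edges joining a vertex strictly between [a] and [b] to
a vertex outside [[a, b]] cross it, and there are at most [k] of them
([crossing_load_le]).

The heart is [exists_low_degree_position].  Suppose that all degrees exceed
[2 t].  The vertex in position [0] then has an edge of span greater than [t];
take an edge [a b] of minimal span [d > t].  All other edges inside [[a, b]]
have span at most [t], so a position [v] strictly between [a] and [b] has at
most [min (v - a) t + min (b - v) t] neighbours in [[a, b]], and sends at
least [1 + (t - (v - a)) + (t - (b - v))] edges across [a b], with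
subtractions truncated at [0].  Summing over the [d - 1 >= t] positions gives
at least [d - 1 + t (t - 1) >= t ^ 2 > k] crossings on [a b], which is too
many. *)

Set Implicit Arguments.
Unset Strict Implicit.
Unset Printing Implicit Defensive.

(** * Counting crossings along a linear order *)

Lemma sum_pred_le_itv (P : pred nat) m n lo hi :
  (forall w, m <= w < n -> P w -> lo <= w < hi) ->
  \sum_(m <= w < n) P w <= hi - lo.
Proof.
move=> P_itv; apply: (@leq_trans (minn n hi - lo)); last by lia.
elim: n P_itv => [|n IHn] P_itv; first by rewrite big_geq.
have {}IHn := IHn (fun w w_int => P_itv w ltac:(lia)).
have [mn|nm] := leqP m n; last by rewrite big_geq.
rewrite big_nat_recr //=.
by case Pn: (P n); [have := P_itv n ltac:(lia) Pn|]; lia.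
Qed.

(** The sum is [(t - 1) + (t - 2) + ... + 0], padded with zeros: the minimal
length [l = t - 1] already contains all nonzero terms. *)
Lemma double_sum_truncated_sub t l : t <= l.+1 ->
  t * t <= t + (\sum_(1 <= i < l.+1) (t - i)).*2.
Proof.
have [//] : (l < t -> (\sum_(1 <= i < l.+1) (t - i)).*2 = l * (t.*2 - l.+1)) /\
  (t <= l.+1 -> t * t <= t + (\sum_(1 <= i < l.+1) (t - i)).*2).
elim: l => [|l [IHlt IHge]]; first by rewrite big_geq //; split; nia.
rewrite big_nat_recr //= doubleD; split=> [lt_lt|].
  by rewrite IHlt; nia.
rewrite leq_eqVlt => /predU1P[t_eq|t_le]; last by have := IHge t_le; lia.
by rewrite IHlt; nia.
Qed.

(** The number of edges that alternate with the chord [a b], when the vertices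
[0, ..., n - 1] are in convex position in this order. *)
Definition crossing_load n (e : rel nat) a b :=
  \sum_(a.+1 <= v < b) (\sum_(0 <= w < a) e v w + \sum_(b.+1 <= w < n) e v w).

(** Both ends of a minimal edge of span more than [t] contribute crossings: the
inner positions near an end have few possible neighbours on that side. *)
Lemma exists_low_degree_position (e : rel nat) n k t :
    0 < n -> k < t * t -> symmetric e -> irreflexive e ->
    (forall a b, a < b < n -> e a b -> crossing_load n e a b <= k) ->
  exists v : 'I_n, \sum_(0 <= w < n) e v w <= t.*2.
Proof.
move=> n_gt0 k_lt e_sym e_irr load_le; apply/existsP; apply: contraT.
rewrite negb_exists => /forallP deg_gt.
have {}deg_gt v : v < n -> t.*2 < \sum_(0 <= w < n) e v w.
  by move=> v_lt; have := deg_gt (Ordinal v_lt); rewrite -ltnNge.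
pose long d := [exists a : 'I_n, exists b : 'I_n, [&& e a b, a + d == b & t < d]].
have long_exists : exists d, long d.
  have [/existsP[b /andP[e0b t_lt]]|no_b] := boolP [exists b : 'I_n, e 0 b && (t < b)].
    exists b; apply/existsP; exists (Ordinal n_gt0); apply/existsP; exists b.
    by rewrite e0b t_lt eqxx.
  have := deg_gt 0 n_gt0; suff: \sum_(0 <= w < n) e 0 w <= t.+1 - 1 by lia.
  apply: sum_pred_le_itv => w w_lt e0w.
  rewrite negb_exists in no_b; have := forallP no_b (Ordinal (w_lt : w < n)).
  rewrite /= e0w /= -leqNgt ltnS => ->.
  by case: w e0w {w_lt} => //; rewrite e_irr.
case: (ex_minnP long_exists) => d /existsP[a /existsP[b /and3P[eab /eqP ab t_lt]]] d_min.
(* Inside the chosen edge [a b], minimality leaves only short edges. *)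
have short v w : a <= v -> v < w -> w <= b -> w - v < d -> e v w -> w - v <= t.
  move=> av vw wb wv evw; rewrite leqNgt; apply/negP => t_lt'.
  have w_lt : w < n by have := ltn_ord b; lia.
  have v_lt : v < n by lia.
  have /d_min : long (w - v); last by lia.
  apply/existsP; exists (Ordinal v_lt); apply/existsP; exists (Ordinal w_lt).
  by rewrite /= evw t_lt' andbT; lia.
have bn := ltn_ord b.
have load_at v : a < v < b ->
    (t - (v - a)) + (t - (b - v)) + 1 <=
    \sum_(0 <= w < a) e v w + \sum_(b.+1 <= w < n) e v w.
  move=> v_int; have := deg_gt v ltac:(lia).
  rewrite (@big_cat_nat _ _ _ a) /=; [|lia..].
  rewrite (@big_cat_nat _ _ _ b.+1 a) /=; [|lia..].
  rewrite (@big_cat_nat _ _ _ v a) /=; [|lia..].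
  have : \sum_(a <= w < v) e v w <= v - maxn a (v - t).
    apply: sum_pred_le_itv => w w_int; rewrite e_sym => ewv.
    by have := short w v ltac:(lia) ltac:(lia) ltac:(lia) ltac:(lia) ewv; lia.
  have : \sum_(v <= w < b.+1) e v w <= minn b.+1 (v + t).+1 - v.+1.
    apply: sum_pred_le_itv => w w_int evw.
    have vw : v != w by apply: contraTneq evw => <-; rewrite e_irr.
    by have := short v w ltac:(lia) ltac:(lia) ltac:(lia) ltac:(lia) evw; lia.
  lia.
have := load_le a b ltac:(lia) eab; rewrite leqNgt; case/negP.
apply: (leq_trans k_lt).
have d_eq : d = d.-1.+1 by lia.
have := @double_sum_truncated_sub t d.-1 ltac:(lia); rewrite -d_eq => sum_ge.
apply: (@leq_trans (\sum_(a.+1 <= v < b) ((t - (v - a)) + (t - (b - v)) + 1))).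
  rewrite !big_split /= sum_nat_const_nat muln1.
  have -> : \sum_(a.+1 <= v < b) (t - (v - a)) = \sum_(1 <= i < d) (t - i).
    rewrite -[in LHS]addn1 addnC -ab [(a + d)%N]addnC big_addn addnK.
    by apply: eq_bigr => i _; rewrite addnK.
  have -> : \sum_(a.+1 <= v < b) (t - (b - v)) = \sum_(1 <= i < d) (t - i).
    rewrite big_nat_rev -[in LHS]addn1 addnC -ab [(a + d)%N]addnC big_addn addnK.
    by apply: eq_big_nat => i i_int; congr (t - _); lia.
  lia.
rewrite /crossing_load big_nat [leqRHS]big_nat.
by apply: leq_sum => v v_int; apply: load_at.
Qed.

Import Order.TTheory GRing.Theory Num.Theory.
Local Open Scope ring_scope.
Local Open Scope classical_set_scope.

(** * Orientation and convex position *)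

(** Twice the signed area of the triangle [a b c], positive when it turns
left. *)
Definition orient (R : realType) (a b c : plane R) : R :=
  (b 0 0 - a 0 0) * (c 0 1 - a 0 1) - (b 0 1 - a 0 1) * (c 0 0 - a 0 0).

Lemma plane_eqP (R : realType) (a b : plane R) :
  a 0 0 = b 0 0 -> a 0 1 = b 0 1 -> a = b.
Proof.
move=> ab0 ab1; apply/rowP => i.
case: i => [[|[|//]]] i_lt; rewrite -/(0 : 'I_1).
- by rewrite [Ordinal _](_ : _ = 0) //; apply: val_inj.
- by rewrite [Ordinal _](_ : _ = 1) //; apply: val_inj.
Qed.

Lemma orient_rot (R : realType) (a b c : plane R) : orient a b c = orient b c a.
Proof. by rewrite /orient; ring. Qed.

Lemma hull_segment (R : realType) (A : set (plane R)) u v s t :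
  hull A u -> hull A v -> 0 <= s -> 0 <= t -> s + t = 1 ->
  hull A (s *: u + t *: v).
Proof.
move=> Au Av s0 t0 st1 C [C_conv AC].
have s1 : s <= 1 by lra.
have Cu : (u : convex_lmodType _) \in C by apply: mem_set; exact: Au.
have Cv : (v : convex_lmodType _) \in C by apply: mem_set; exact: Av.
have := C_conv u v (Itv01 s0 s1) Cu Cv => /set_mem.
have -> : t = 1 - s by lra.
done.
Qed.

Lemma hull_combination3 (R : realType) (A : set (plane R)) u v w z al be ga :
  A u -> A v -> A w -> 0 < al -> 0 < be -> 0 < ga ->
  (al + be + ga) *: z = al *: u + be *: v + ga *: w -> hull A z.
Proof.
move=> Au Av Aw al0 be0 ga0 z_eq.
have sub x : A x -> hull A x by move=> Ax; apply: sub_gen_smallest.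
set s := al + be; set T := s + ga.
have s0 : 0 < s by apply: addr_gt0.
have T0 : 0 < T by apply: addr_gt0.
have -> : z = (s / T) *: ((al / s) *: u + (be / s) *: v) + (ga / T) *: w.
  apply: (@scalerI _ _ T); first by rewrite gt_eqF.
  rewrite z_eq !scalerDr !scalerA.
  by congr (_ *: _ + _ *: _ + _ *: _); field; rewrite ?gt_eqF.
by do 2?apply: hull_segment;
  rewrite ?divr_ge0 ?(ltW al0) ?(ltW be0) ?(ltW ga0) ?(ltW s0) ?(ltW T0) //;
  try exact: sub; rewrite -mulrDl divff ?gt_eqF.
Qed.

(** The three orientations are, up to normalisation, the barycentric
coordinates of [p z] in the triangle. *)
Lemma not_in_triangle (R : realType) (V : finType) (p : V -> plane R) z a b c :
  convex_position p -> z != a -> z != b -> z != c ->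
  0 < orient (p a) (p b) (p z) -> 0 < orient (p b) (p c) (p z) ->
  0 < orient (p c) (p a) (p z) -> False.
Proof.
move=> p_conv za zb zc oab obc oca; apply: (p_conv z).
apply: (hull_combination3 _ _ _ obc oca oab).
- by exists a => //=; rewrite eq_sym.
- by exists b => //=; rewrite eq_sym.
- by exists c => //=; rewrite eq_sym.
by apply: plane_eqP; rewrite !mxE /orient; ring.
Qed.

Lemma orient_neq0 (R : realType) (V : finType) (p : V -> plane R) u v w :
  injective p -> no_three_collinear p -> u != v -> v != w -> u != w ->
  orient (p u) (p v) (p w) != 0.
Proof.
move=> p_inj no3 uv vw uw; apply/eqP => o0; apply: (no3 u v w) => //.
exists (p u), (p v - p u); split.
  by rewrite subr_eq0; apply: contra_neq uv => /p_inj.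
have pvu : p v - p u != 0.
  by rewrite subr_eq0; apply: contra_neq uv => /p_inj.
move=> z /= [[->|->]|->].
- by exists 0 => //; rewrite scale0r addr0.
- by exists 1 => //; rewrite scale1r addrC subrK.
(* On the line through [p u] directed by [p v - p u], the parameter of [p w] is a
quotient of coordinate differences, for whichever coordinate is not constant. *)
have [x0|x_neq0] := eqVneq (p v 0 0 - p u 0 0) 0.
  have y_neq0 : p v 0 1 - p u 0 1 != 0.
    apply: contra_neq pvu => y0; apply: plane_eqP; rewrite !mxE //.
  exists ((p w 0 1 - p u 0 1) / (p v 0 1 - p u 0 1)) => //.
  move: o0; rewrite /orient x0 mul0r sub0r => /eqP.
  rewrite oppr_eq0 mulf_eq0 (negPf y_neq0) /= => /eqP w0.
  apply: plane_eqP; rewrite !mxE.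
    by rewrite x0 mulr0; lra.
  by field.
exists ((p w 0 0 - p u 0 0) / (p v 0 0 - p u 0 0)) => //.
apply: plane_eqP; rewrite !mxE; first by field.
apply/(mulfI x_neq0).
transitivity ((p v 0 0 - p u 0 0) * p u 0 1 +
              (p v 0 1 - p u 0 1) * (p w 0 0 - p u 0 0)).
  by field.
by move: o0; rewrite /orient; lra.
Qed.

(** The four triangles of the quadrilateral give an affine dependence between
its vertices; splitting it by signs exhibits the common point of the two
diagonals as a convex combination of the endpoints of each of them. *)
Lemma chords_meet (R : realType) (p q r s : plane R) :
  0 < orient p q r -> 0 < orient p q s -> 0 < orient p r s ->
  0 < orient q r s -> open_segment p r `&` open_segment q s !=set0.
Proof.
move=> pqr pqs prs qrs.
set T := orient q r s + orient p q s.
have T0 : 0 < T by apply: addr_gt0.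
have T0' : T != 0 by rewrite gt_eqF.
have TE : T = orient p r s + orient p q r by rewrite /T /orient; ring.
have in01 x y : 0 < x -> 0 < y -> T = x + y -> (y / T) \in (`]0, 1[)%O.
  by move=> x0 y0 ->; rewrite in_itv /= divr_gt0 ?addr_gt0 // ltr_pdivrMr ?addr_gt0 // mul1r ltrDr.
exists (T^-1 *: (orient q r s *: p + orient p q s *: r)); split.
  exists (orient p q s / T); first exact: in01 qrs pqs erefl.
  rewrite scalerDr !scalerA; congr (_ *: _ + _ *: _).
    by rewrite -[1](divff T0') -mulrBl mulrC /T addrK.
  by rewrite mulrC.
exists (orient p q r / T); first exact: in01 prs pqr TE.
apply: (@scalerI _ _ T) => //; rewrite scalerA divff // scale1r scalerDr !scalerA.
rewrite mulrBr mulr1 mulrCA divff // mulr1 {1}TE addrK.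
by apply: plane_eqP; rewrite !mxE /orient; ring.
Qed.

(** * Counterclockwise enumerations *)

Definition counterclockwise (R : realType) (V : finType) (p : V -> plane R)
    (x0 : V) (s : seq V) :=
  forall i j k, (i < j < k)%N -> (k < size s)%N ->
  0 < orient (p (nth x0 s i)) (p (nth x0 s j)) (p (nth x0 s k)).

(** Sort the points by angle around one of them, [o].  Convex position enters
twice: the angular relation is transitive since [o] lies in no triangle, and a
right turn at three later points would put the middle one in the triangle
formed by [o] and the other two. *)
Lemma exists_counterclockwise_enum (R : realType) (V : finType)
    (p : V -> plane R) (S : {set V}) (o : V) :
  injective p -> convex_position p -> no_three_collinear p -> o \in S ->
  exists s, [/\ uniq s, s =i S & counterclockwise p o s].
Proof.
move=> p_inj p_conv no3 oS.
pose leq_angle u v := (u == v) || (0 < orient (p o) (p u) (p v)).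
have neq0 u v w := @orient_neq0 _ _ p u v w p_inj no3.
have leq_total : {in predC1 o &, total leq_angle}.
  move=> u v /=; rewrite !inE => uo vo; rewrite /leq_angle [v == u]eq_sym.
  have [//|uv /=] := eqVneq u v.
  have := neq0 o u v; rewrite eq_sym uo uv eq_sym vo => /(_ isT isT isT).
  rewrite neq_lt => /orP[o_lt|->//]; apply/orP; right.
  by move: o_lt; rewrite /orient; lra.
have leq_trans_angle : {in predC1 o & &, transitive leq_angle}.
  move=> v u w; rewrite !inE => vo uo wo.
  rewrite /leq_angle => /predU1P[->//|ouv] /predU1P[<-|ovw]; first by rewrite ouv orbT.
  have [//|uw /=] := eqVneq u w.
  have := neq0 o u w; rewrite eq_sym uo uw eq_sym wo => /(_ isT isT isT).
  rewrite neq_lt => /orP[o_lt|//]; exfalso.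
  (* Three points turning left cyclically around [o] enclose it. *)
  apply: (@not_in_triangle _ _ p o u v w p_conv); rewrite 1?eq_sym //.
  - by rewrite -orient_rot.
  - by rewrite -orient_rot.
  - by move: o_lt; rewrite /orient; lra.
pose r := sort leq_angle (enum (S :\ o)).
have r_mem x : x \in r = (x != o) && (x \in S).
  by rewrite mem_sort mem_enum !inE.
have r_uniq : uniq r by rewrite sort_uniq enum_uniq.
have r_o : all (predC1 o) r by apply/allP => x; rewrite r_mem => /andP[].
have r_pair : pairwise leq_angle r.
  rewrite -(sorted_pairwise_in leq_trans_angle r_o).
  apply: (sort_sorted_in leq_total).
  by apply/allP => x; rewrite mem_enum !inE => /andP[].
have nth_neq i j : (i < j < size r)%N -> nth o r i != nth o r j.
  by move=> ij; rewrite nth_uniq //; lia.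
have nth_o i : (i < size r)%N -> nth o r i != o.
  by move=> i_lt; apply: (allP r_o); apply: mem_nth.
have r_lt i j : (i < j < size r)%N -> 0 < orient (p o) (p (nth o r i)) (p (nth o r j)).
  move=> ij; have /(pairwiseP o) r_homo := r_pair.
  have : leq_angle (nth o r i) (nth o r j).
    have /andP[i_lt j_lt] := ij.
    by apply: r_homo; rewrite // -topredE /= (ltn_trans i_lt).
  by rewrite /leq_angle (negPf (nth_neq i j ij)).
exists (o :: r); split.
- by rewrite /= r_uniq r_mem eqxx.
- by move=> x; rewrite inE r_mem; case: eqVneq => // ->.
move=> [|i] [|j] [|k] /andP[] //; rewrite !ltnS => i_lt_j j_lt_k k_lt /=.
  by apply: r_lt; rewrite j_lt_k.
have j_lt : (j < size r)%N by apply: ltn_trans k_lt.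
have ij : (i < j < size r)%N by rewrite i_lt_j.
have jk : (j < k < size r)%N by rewrite j_lt_k.
have ik : (i < k < size r)%N by rewrite (ltn_trans i_lt_j).
have := neq0 _ _ _ (nth_neq i j ij) (nth_neq j k jk) (nth_neq i k ik).
rewrite neq_lt => /orP[o_lt|//]; exfalso.
have oij := r_lt i j ij; have ojk := r_lt j k jk; have oik := r_lt i k ik.
apply: (@not_in_triangle _ _ p (nth o r j) o (nth o r i) (nth o r k) p_conv).
- exact: nth_o.
- by rewrite eq_sym; apply: nth_neq.
- exact: nth_neq.
- exact: oij.
- by move: o_lt; rewrite /orient; lra.
- by move: ojk; rewrite /orient; lra.
Qed.

(** * Crossings in a k-plane convex drawing *)

Lemma sum_nat_ord n m1 m2 (F : nat -> nat) : (m2 <= n)%N ->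
  (\sum_(m1 <= i < m2) F i = \sum_(i < n | m1 <= i < m2) F i)%N.
Proof.
move=> m2n; rewrite big_geq_mkord (big_ord_widen_cond _ _ _ m2n).
by apply: eq_bigl => i /=; lia.
Qed.

Lemma crossing_load_card n (e : rel nat) a b : (b < n)%N ->
  crossing_load n e a b =
  #|[set vw : 'I_n * 'I_n | [&& (a < vw.1 < b)%N, ((vw.2 < a) || (b < vw.2))%N
                              & e vw.1 vw.2]]%SET|.
Proof.
move=> bn; rewrite -sum1dep_card /crossing_load (@sum_nat_ord n) 1?ltnW //.
have [ba|ab] := leqP b a.
  by rewrite !big_pred0 // => i; [apply/negbTE; lia|apply/negbTE; case: i => ? ?/=; lia].
transitivity (\sum_(v < n | (a < v < b)%N) \sum_(w < n | ((w < a) || (b < w))%N) e v w)%N.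
  apply: eq_bigr => v _; rewrite (@sum_nat_ord n 0) 1?(@sum_nat_ord n b.+1) //; last by lia.
  rewrite [X in (X + _)%N]big_mkcond [X in (_ + X)%N]big_mkcond [RHS]big_mkcond -big_split.
  apply: eq_bigr => w _ /=; rewrite ltn_ord andbT.
  by case: (ltnP w a); case: (ltnP b w); rewrite ?addn0 //; lia.
rewrite pair_big_dep big_mkcond [RHS]big_mkcond; apply: eq_bigr => -[v w] _ /=.
by rewrite andbA; case: (e v w); rewrite ?andbT ?andbF //; case: ifP.
Qed.

Lemma set2_inj_separated (T : finType) (D : pred T) x y x' y' :
  D x -> ~~ D y -> D x' -> ~~ D y' -> [set x; y]%SET = [set x'; y']%SET ->
  x = x' /\ y = y'.
Proof.
move=> Dx Dy Dx' Dy' /setP eq_xy; split.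
  have := eq_xy x; rewrite !inE eqxx /= => /esym/orP[/eqP//|/eqP x_eq].
  by rewrite -x_eq Dx in Dy'.
have := eq_xy y; rewrite !inE eqxx orbT => /esym/orP[/eqP y_eq|/eqP//].
by rewrite y_eq Dx' in Dy.
Qed.

(** An edge counted in the load has exactly one endpoint strictly between [a]
and [b], so it is counted once, and it crosses the chord [a b]. *)
Lemma crossing_load_le (R : realType) (G : sgraph) (p : G -> plane R) k x0 s a b :
  k_plane k p -> uniq s -> counterclockwise p x0 s -> (a < b < size s)%N ->
  adj (nth x0 s a) (nth x0 s b) ->
  (crossing_load (size s) (fun i j => adj (nth x0 s i) (nth x0 s j)) a b <= k)%N.
Proof.
move=> p_k s_uniq s_ccw ab adj_ab; set n := size s; set e := fun i j => _.
pose E := [set nth x0 s a; nth x0 s b]%SET.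
have E_edge : E \in edges G by apply/imset2P; exists (nth x0 s a) (nth x0 s b); rewrite ?inE.
apply: leq_trans (p_k E E_edge).
pose C := [set vw : 'I_n * 'I_n |
  [&& (a < vw.1 < b)%N, ((vw.2 < a) || (b < vw.2))%N & e vw.1 vw.2]]%SET.
pose f (vw : 'I_n * 'I_n) := [set nth x0 s vw.1; nth x0 s vw.2]%SET.
have -> : crossing_load n e a b = #|C|.
  exact: crossing_load_card (ltac:(lia) : (b < n)%N).
rewrite -(@card_in_imset _ _ f C).
  apply: subset_leq_card; apply/fintype.subsetP => F /imsetP[[v w]].
  rewrite inE /= => /and3P[v_int w_out evw] F_eq; rewrite inE.
  apply/andP; split.
    by rewrite F_eq; apply/imset2P; exists (nth x0 s v) (nth x0 s w); rewrite ?inE.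
  apply/asboolP.
  have EF : E != F.
    apply/eqP => EF; have : nth x0 s v \in E by rewrite EF F_eq !inE eqxx.
    by rewrite !inE !nth_uniq //; lia.
  have vn := ltn_ord v; have wn := ltn_ord w.
  split=> //; case/orP: w_out => [wa|bw].
    have [||||c [c_wv c_ab]] :=
      @chords_meet R (p (nth x0 s w)) (p (nth x0 s a)) (p (nth x0 s v)) (p (nth x0 s b));
      [by apply: s_ccw; rewrite -?/n; lia.. |].
    exists c; split; first by exists (nth x0 s a), (nth x0 s b).
    by exists (nth x0 s w), (nth x0 s v); rewrite F_eq finset.setUC.
  have [||||c [c_ab c_vw]] :=
    @chords_meet R (p (nth x0 s a)) (p (nth x0 s v)) (p (nth x0 s b)) (p (nth x0 s w));
    [by apply: s_ccw; rewrite -?/n; lia.. |].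
  exists c; split; first by exists (nth x0 s a), (nth x0 s b).
  by exists (nth x0 s v), (nth x0 s w); rewrite F_eq.
move=> [v w] [v' w']; rewrite !inE /= => /and3P[v_int w_out _] /and3P[v'_int w'_out _] f_eq.
have nthK (i : 'I_n) : index (nth x0 s i) s = i by rewrite index_uniq.
(* The vertices strictly between the ends of the chord tell the inner endpoint of
a counted edge from the outer one. *)
pose D := [pred x | a < index x s < b]%N.
have [||||v_eq w_eq] := @set2_inj_separated _ D _ _ _ _ _ _ _ _ f_eq; rewrite /= ?nthK //; [lia..|].
by congr (_, _); apply: val_inj; rewrite /= -[LHS]nthK ?v_eq ?w_eq nthK.
Qed.

Lemma exists_low_degree_vertex (R : realType) (G : sgraph) (p : G -> plane R) k t (S : {set G}) :
  convex_geometric p -> k_plane k p -> (k < t * t)%N -> S != finset.set0 ->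
  exists2 v, v \in S & (#|[set u in S | adj v u]%SET| <= t.*2)%N.
Proof.
move=> [p_inj p_conv no3] p_k kt /set0Pn[o oS].
have [s [s_uniq s_S s_ccw]] := exists_counterclockwise_enum p_inj p_conv no3 oS.
have s_gt0 : (0 < size s)%N by have := oS; rewrite -s_S; case: (s).
pose e i j := adj (nth o s i) (nth o s j).
have e_sym : symmetric e by move=> i j; apply: adj_sym.
have e_irr : irreflexive e by move=> i; apply: adj_irrefl.
have [|v v_low] := exists_low_degree_position s_gt0 kt e_sym e_irr.
  by move=> a b ab eab; apply: (crossing_load_le p_k).
exists (nth o s v); first by rewrite -s_S mem_nth.
apply: leq_trans v_low; rewrite -sum1dep_card big_mkcondr /=.
rewrite -[leqRHS](big_nth o (r := s) xpredT (fun u => adj (nth o s v) u : nat)).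
rewrite big_uniq // (eq_bigl _ _ s_S).
by apply: leq_sum => u _; case: adj.
Qed.

(** * Degeneracy and the edge bound *)

(** Delete a low-degree vertex [v] of the current set [S]: the edges lost are the
pairs [v u] with [u] a neighbour of [v] in [S]. *)
Lemma edges_le_of_degenerate (G : sgraph) d :
  (forall S : {set G}, S != finset.set0 ->
    exists2 v, v \in S & (#|[set u in S | adj v u]%SET| <= d)%N) ->
  (#|edges G| <= d * #|G|)%N.
Proof.
move=> low.
have sub_le m (S : {set G}) : #|S| = m -> (#|[set E in edges G | E \subset S]%SET| <= d * m)%N.
  elim: m S => [|m IHm] S S_m.
    move/eqP: S_m; rewrite cards_eq0 => /eqP ->.
    rewrite muln0 leqn0 cards_eq0; apply/eqP/setP => E; rewrite !inE.
    apply/negbTE/andP => -[/imset2P[x y _ _ ->]].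
    by rewrite finset.subUset finset.sub1set inE.
  have [|v vS v_low] := low S; first by rewrite -card_gt0 S_m.
  have Sv_m : #|S :\ v| = m by move: S_m; rewrite (cardsD1 v) vS => -[].
  have := IHm _ Sv_m => {}IHm.
  apply: (@leq_trans #|[set E in edges G | E \subset S :\ v] :|:
     [set [set v; u] | u in [set u in S | adj v u]]|%SET).
    apply: subset_leq_card; apply/fintype.subsetP => E; rewrite !inE => /andP[E_edge ES].
    rewrite E_edge /=; have [vE|vE] := boolP (v \in E); last by rewrite finset.subsetD1 ES vE.
    apply/orP; right; move: E_edge ES vE => /imset2P[x y _]; rewrite inE => /andP[_ xy] ->.
    rewrite finset.subUset !finset.sub1set !inE => /andP[xS yS] /orP[]/eqP v_eq.
      by apply/imsetP; exists y; rewrite ?inE v_eq ?yS.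
    by apply/imsetP; exists x; rewrite ?inE v_eq ?xS 1?adj_sym // finset.setUC.
  rewrite mulnS addnC; apply: leq_trans (leq_card_setU _ _) _.
  by apply: leq_add => //; apply: leq_trans (leq_imset_card _ _) v_low.
have := sub_le _ [set: G]%SET (cardsT _).
by congr (_ <= _)%N; apply: eq_card => E; rewrite !inE finset.subsetT andbT.
Qed.

Lemma exists_sqrt_succ k : exists t, (t * t <= k < t.+1 * t.+1)%N.
Proof.
have ex : exists i, (i * i <= k)%N by exists 0%N.
have ub i : (i * i <= k -> i <= k)%N by nia.
by case: (ex_maxnP ex ub) => t t_le t_max; exists t; rewrite t_le ltnNge; apply/negP => /t_max; lia.
Qed.

Local Close Scope classical_set_scope.

Theorem theorem3 (R : realType) (k : nat) (hk : (5 <= k)%N)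
    (G : sgraph) (n : nat) (hn : #|G| = n) (hG : outer_k_planar R k G) :
  #|edges G|%:R <= (285%:R / 100%:R) * Num.sqrt (k%:R) * n%:R :> R.
Proof.
have [p [p_geo p_k]] := hG.
(* Here [t] is the integer part of [sqrt k]; the degrees are bounded by
[2 (t + 1)]. *)
have [t /andP[t_le t_lt]] := exists_sqrt_succ k.
have := edges_le_of_degenerate (fun S => @exists_low_degree_vertex R G p k t.+1 S p_geo p_k t_lt).
rewrite hn -(ler_nat R) natrM => edges_le; apply: le_trans edges_le _.
apply: ler_wpM2r; first exact: ler0n.
set x := Num.sqrt _.
have x0 : 0 <= x by apply: sqrtr_ge0.
have xx : x * x = k%:R by rewrite -expr2 sqr_sqrtr.
have tx : t%:R <= x by rewrite -(ler_pXn2r (n := 2)) ?nnegrE // !expr2 xx -natrM ler_nat.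
rewrite -muln2 natrM -natr1.
(* [2 (x + 1) <= 2.85 x] needs [x >= 2.353], and [sqrt 6 > 2.353 > sqrt 5]. *)
have [k6|] := leqP 6 k.
  have : (6%:R : R) <= k%:R by rewrite ler_nat.
  by nra.
rewrite ltnS => k5; have k_eq : k = 5%N by lia.
have t2 : t = 2%N by nia.
by rewrite t2; move: xx; rewrite k_eq; nra.
Qed.
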